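(* For each positive integer $p$ there exists a polynomial $P_p$ such that for every finite loopless multigraph $G$, $$\Big(\widetilde\nabla^{\rm m}_{(p-1)/2}(G)\Big)^{1/p}\le {\rm Arb}_p(G)\le P_p\Big(\widetilde\nabla^{\rm m}_{(p-1)/2}(G)\Big).$$
   Context: All multigraphs are finite and loopless; cycles include $2$-cycles formed by two parallel edges, and $|C|$ is the number of edges of a cycle $C$. ${\rm Arb}_p(G)$ is the minimum number of colours in an edge colouring of $G$ such that every cycle $C$ of $G$ receives at least $\min(|C|,p+1)$ distinct colours. For a half-integer $r\ge0$, $\widetilde\nabla^{\rm m}_r(G)$ is the maximum of $\|H\|/|H|$ over all loopless multigraphs $H$ such that some $\le 2r$-subdivision of $H$ (each edge, each parallel copy separately, replaced by a path with at most $2r$ internal vertices, the paths internally disjoint) is a subgraph of $G$; $\|H\|$ counts edges with multiplicity and $|H|$ is the number of vertices. *)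

(* Defs.v *)
From HB Require Import structures.
From mathcomp Require Import all_boot all_order all_algebra.
From Stdlib Require Import ClassicalEpsilon.
Set Implicit Arguments. Unset Strict Implicit. Unset Printing Implicit Defensive.
Import Order.TTheory GRing.Theory Num.Theory.

Definition pb (P : Prop) : bool :=
  if excluded_middle_informative P then true else false.

Lemma pbT (P : Prop) : P -> pb P.
Proof. by rewrite /pb; case: excluded_middle_informative. Qed.

(* A finite multigraph: finite vertex type V, finite edge type E, and the
   two endpoints of each edge.  Parallel edges = distinct edges with the same
   endpoints.  Loopless: the two endpoints differ. *)
Section Multigraph.
Variables (V E : finType) (ends : E -> V * V).

Definition loopless : Prop := forall e, (ends e).1 != (ends e).2.

Definition joins (e : E) (x y : V) : bool :=
  (ends e == (x, y)) || (ends e == (y, x)).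

(* C is (the edge set of) a cycle of G: distinct vertices v_0..v_{k-1}
   (k >= 2) and distinct edges e_0..e_{k-1}, e_i joining v_i and v_{i+1 mod k}.
   For k = 2 this is a 2-cycle formed by two parallel edges. *)
Definition is_cycle (C : {set E}) : Prop :=
  exists (vs : seq V) (es : seq E),
    [/\ 2 <= size vs, size es = size vs, uniq vs & uniq es] /\
    C = [set e in es] /\
        all (fun t => joins t.1 t.2.1 t.2.2) (zip es (zip vs (rot 1 vs))).

Definition arb_colouring (p k : nat) (col : E -> 'I_k) : Prop :=
  forall C : {set E}, is_cycle C -> minn #|C| p.+1 <= #|col @: C|.

Definition arb_ok (p k : nat) : Prop := exists col : E -> 'I_k, @arb_colouring p k col.

Lemma arb_ok_exists (p : nat) : exists k, pb (arb_ok p k).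
Proof.
exists #|E|; apply: pbT; exists enum_rank.
move=> C _; rewrite card_in_imset ?geq_minl //.
by move=> x y _ _ /enum_rank_inj.
Qed.

Definition Arb (p : nat) : nat := ex_minn (arb_ok_exists p).

(* A <= k-subdivision of the multigraph H = (VH, EH, endsH) is a subgraph of G:
   an injective map phi of branch vertices, and for each edge f of H a path
   (phi a) :: ws in G from phi a to phi b (ends f = (a,b)) with 1 <= |ws| <= k+1
   edges (so at most k internal vertices), using edges pe f; the internal
   vertices avoid the branch vertices; distinct edges of H use disjoint edge
   sets and disjoint sets of internal vertices. *)
Definition interior (ws : seq V) : seq V := take (size ws).-1 ws.

Definition subdiv_in (VH EH : finType) (endsH : EH -> VH * VH) (k : nat) : Prop :=
  exists (phi : VH -> V) (pv : EH -> seq V) (pe : EH -> seq E),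
    [/\ injective phi,
        forall f, let x := phi (endsH f).1 in
          [/\ 0 < size (pv f) <= k.+1, size (pe f) = size (pv f),
              uniq (x :: pv f) & uniq (pe f)] /\
          [/\ last x (pv f) = phi (endsH f).2,
              all (fun t => joins t.1 t.2.1 t.2.2) (zip (pe f) (zip (x :: pv f) (pv f)))
            & forall v, v \in interior (pv f) -> v \notin codom phi]
      & forall f f', f != f' ->
          ~~ has (mem (pe f')) (pe f) /\
          ~~ has (mem (interior (pv f'))) (interior (pv f))].

End Multigraph.


(* \tilde\nabla^m_r(G) with 2r = k: maximum of ||H||/|H| over loopless multigraphs
   H having a <= k-subdivision as a subgraph of G.  Such an H has at most |V(G)|
   vertices and at most |E(G)| edges, so up to isomorphism H ranges over
   multigraphs on vertex set 'I_n, edge set 'I_m, n <= |V(G)|, m <= |E(G)|.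
   (Max with default 0; all ratios are >= 0.) *)
Definition nabla_m (V E : finType) (ends : E -> V * V) (k : nat) : rat :=
  \big[Num.max/0%R]_(n < #|V|.+1)
   \big[Num.max/0%R]_(m < #|E|.+1)
    \big[Num.max/0%R]_(h : {ffun 'I_m -> 'I_n * 'I_n} |
        pb (loopless h /\ subdiv_in ends h k))
      ((m%:R : rat) / (n%:R : rat))%R.

(* Main.v *)
Require Import Defs.
From HB Require Import structures.
From mathcomp Require Import all_boot all_order all_algebra.
From mathcomp Require Import zify.
From Stdlib Require Import ClassicalEpsilon.
Import Order.TTheory GRing.Theory Num.Theory.
Set Implicit Arguments. Unset Strict Implicit. Unset Printing Implicit Defensive.

(* Lower bound: give each edge of H the word of colours along its subdividing path, a path with at
   most p edges.  The edges carrying a fixed word span a forest, so ||H|| <= Arb_p(G)^p |H|.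

   Upper bound: let b bound ||H||/|H|.  For a vertex set S, the edges lying on paths of length at
   most q with both ends in S number at most (1 + pb)^q |S|: the interiors of a maximal family of
   internally disjoint such paths add at most pb|S| vertices to S and cut the remaining paths into
   shorter ones.  Hence some v in S meets few of these edges for q = p.  Removing such vertices one
   after the other orders V so that every x meets few edges that lie on a path of length at most p
   with both ends <= x; call them the down edges of x.  Colour the edges so that any two down edges
   of vertices at distance at most 2p along down edges differ.  Given a cycle, start at its least
   vertex and repeatedly split at the least interior vertex v.  As soon as both halves have length
   at most p all their edges are close to v, hence of distinct colours; at that moment either the
   halves form the whole cycle or together they have more than p edges. *)

Lemma pbP (P : Prop) : reflect P (pb P).
Proof. by rewrite /pb; case: excluded_middle_informative => H; constructor. Qed.

(** * Walks *)

Local Notation edg := (map fst).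
Local Notation vtx := (map snd).

Section Walks.
Variables (V E : finType) (ends : E -> V * V).
Implicit Types (x y z v w : V) (e : E) (s t : seq (E * V)).

(* A walk from [x] is the list of the traversed edges, each with the vertex it leads to. *)
Fixpoint walk x s : bool :=
  if s is (e, y) :: s' then joins ends e x y && walk y s' else true.

Definition wend x s : V := last x (vtx s).

Definition spath x s : bool := walk x s && uniq (x :: vtx s).

Lemma joinsC e x y : joins ends e x y = joins ends e y x.
Proof. by rewrite /joins orbC. Qed.

Lemma joins_mem e x y z w : joins ends e x y -> joins ends e z w ->
  (z == x) && (w == y) || (z == y) && (w == x).
Proof. by rewrite /joins => /orP[]/eqP-> /orP[]/eqP[-> ->]; rewrite !eqxx ?orbT. Qed.

Lemma joins_ends e : joins ends e (ends e).1 (ends e).2.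
Proof. by rewrite /joins -surjective_pairing eqxx. Qed.

Lemma joins_neq e x y : loopless ends -> joins ends e x y -> x != y.
Proof.
move=> ll; have := ll e; rewrite /joins => h /orP[]/eqP He; move: h; rewrite He //=.
by rewrite eq_sym.
Qed.

Lemma wend_cat x s t : wend x (s ++ t) = wend (wend x s) t.
Proof. by rewrite /wend map_cat last_cat. Qed.

Lemma walk_cat x s t : walk x (s ++ t) = walk x s && walk (wend x s) t.
Proof. by elim: s x => [|[e y] s IH] x //=; rewrite IH andbA. Qed.

(** Edges are stored with their targets, so reversal shifts the pairing of edges with vertices by
    one; the reversed walk is therefore described by its two projections. *)
Lemma walk_rev x s : walk x s -> exists t,
  [/\ walk (wend x s) t, wend (wend x s) t = x, edg t = rev (edg s)
    & wend x s :: vtx t = rev (x :: vtx s)].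
Proof.
elim: s x => [|[e y] s IH] x /=; first by exists [::].
case/andP=> He /IH[t [w1 w2 w3 w4]]; exists (rcons t (e, x)).
rewrite -cats1 walk_cat wend_cat [wend x _]/wend /= -/(wend y s) w1 w2 /= joinsC He.
split=> //; first by rewrite map_cat w3 rev_cons cats1.
by rewrite map_cat /= -cat_cons w4 (rev_cons x) cats1.
Qed.

Lemma spath_rev x s : spath x s -> exists t,
  [/\ spath (wend x s) t, wend (wend x s) t = x, edg t = rev (edg s)
    & wend x s :: vtx t = rev (x :: vtx s)].
Proof.
case/andP=> /walk_rev[t [w1 w2 w3 w4]] u; exists t; split=> //.
by rewrite /spath w1 w4 rev_uniq.
Qed.

Lemma walk_mem x s e z w : walk x s -> e \in edg s -> joins ends e z w ->
  z \in x :: vtx s.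
Proof.
elim: s x => [|[e' y] s IH] x //= /andP[He Hs]; rewrite inE => /orP[/eqP->|He'] Hj.
  by case/orP: (joins_mem He Hj) => /andP[/eqP-> _]; rewrite !inE eqxx ?orbT.
by rewrite inE (IH y) ?orbT.
Qed.

(** A second occurrence of the first edge would bring the path back to its start. *)
Lemma spath_uniq_edges x s : spath x s -> uniq (edg s).
Proof.
rewrite /spath; elim: s x => [|[e y] s IH] x //= /andP[/andP[He Hs]] /and3P[nx ny us].
rewrite (IH y) /= ?Hs ?ny // andbT; apply: contra nx => es.
exact: walk_mem Hs es He.
Qed.

Lemma spath_cat x s t : spath x (s ++ t) -> spath x s /\ spath (wend x s) t.
Proof.
rewrite /spath walk_cat => /andP[/andP[-> ->]]; rewrite map_cat -cat_cons.
rewrite cat_uniq => /and3P[-> u2 u3]; split=> //=; rewrite u3 andbT.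
by apply: contra u2 => h; apply/hasP; exists (wend x s); rewrite ?mem_last.
Qed.

Lemma split_vertex s v : v \in vtx s -> exists a e b, s = a ++ (e, v) :: b.
Proof.
case/mapP=> -[e w] /= hs ->; have [a b] := splitPr hs.
by exists a, e, b.
Qed.

Lemma split_edge s e : e \in edg s -> exists a v b, s = a ++ (e, v) :: b.
Proof.
case/mapP=> -[e' w] /= hs ->; have [a b] := splitPr hs.
by exists a, w, b.
Qed.

Lemma interior_rcons (ws : seq V) z : interior (rcons ws z) = ws.
Proof. by rewrite /interior size_rcons -cats1 take_size_cat. Qed.

Lemma all_joinsE x (es : seq E) (ws : seq V) : all (fun q => joins ends q.1 q.2.1 q.2.2)
  (zip es (zip (x :: ws) ws)) = walk x (zip es ws).
Proof. by elim: ws es x => [|w ws IH] [|e es] x //=; rewrite IH. Qed.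

Lemma edg_zip (es : seq E) (ws : seq V) : size es = size ws -> edg (zip es ws) = es.
Proof. by move=> h; apply: unzip1_zip; rewrite h. Qed.

Lemma vtx_zip (es : seq E) (ws : seq V) : size es = size ws -> vtx (zip es ws) = ws.
Proof. by move=> h; apply: unzip2_zip; rewrite h. Qed.

Lemma zip_edg_vtx s : zip (edg s) (vtx s) = s.
Proof. exact: zip_unzip. Qed.

(** The start is listed in [vtx s] once, as the last vertex. Distinctness of the edges matters for
    two steps, where a single edge could otherwise be walked to and fro. *)
Definition closed_walk x s : bool :=
  [&& walk x s, wend x s == x, uniq (vtx s), uniq (edg s) & 1 < size s].

Lemma closed_walkP (C : {set E}) :
  is_cycle ends C <-> exists x s, closed_walk x s /\ C = [set e in edg s].
Proof.
have key x (w : seq V) z (es : seq E) : all (fun q => joins ends q.1 q.2.1 q.2.2)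
    (zip es (zip (x :: w) (rcons w z))) = walk x (zip es (rcons w z)).
  by elim: w es x => [|y w IH] [|e es] x //=; [case: es | rewrite IH].
split.
- case=> -[|z w] [es [[s2 ses u1 u2] [-> ]]] //; rewrite rot1_cons key => Hw.
  have ss : size es = size (rcons w z) by rewrite size_rcons ses.
  exists z, (zip es (rcons w z)); split; last by rewrite edg_zip ?ss.
  rewrite /closed_walk Hw /wend edg_zip ?vtx_zip ?ss // last_rcons eqxx u2.
  by rewrite size1_zip ?ss // size_rcons rcons_uniq; move: u1 s2 => /= -> ->.
case=> x [s [/and5P[Hw We u1 u2 s2] ->]].
have [w Ew] : exists w : seq V, vtx s = rcons w x.
  move: We s2; rewrite /wend; case/lastP: s {Hw u1 u2} => // s [e y] /=.
  by rewrite map_rcons last_rcons => /eqP<- _; exists (vtx s).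
exists (x :: w), (edg s); have sw : size s = (size w).+1.
  by rewrite -(size_map snd) Ew size_rcons.
split; first by rewrite size_map /= -sw; split=> //; move: u1; rewrite Ew rcons_uniq.
by split=> //; rewrite rot1_cons key -Ew zip_edg_vtx.
Qed.

End Walks.

(** * Greedy arguments *)

Lemma greedy_colouring (T : finType) (r : rel T) (d : nat) : symmetric r ->
  (forall x, #|[set y | r x y]| <= d) ->
  exists c : T -> 'I_d.+1, forall x y, x != y -> r x y -> c x != c y.
Proof.
move=> rC rd.
suff [c Hc] : exists c : T -> 'I_d.+1,
    {in enum T &, forall x y, x != y -> r x y -> c x != c y}.
  by exists c => x y; apply: Hc; rewrite mem_enum.
elim: (enum T) => [|a s [c IH]]; first by exists (fun=> ord0).
(* The new colour avoids all neighbours of [a], whether already coloured or not, so at most [d] of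
   the [d.+1] colours are forbidden. *)
have [k Hk] : exists k, k \notin c @: [set y | r a y].
  apply/existsP; rewrite -negb_forall; apply/negP => /forallP H.
  have : #|'I_d.+1| <= #|c @: [set y | r a y]|.
    by apply: subset_leq_card; apply/subsetP => k _.
  by rewrite card_ord leqNgt ltnS (leq_trans (leq_imset_card _ _) (rd a)).
exists (fun x => if x == a then k else c x) => x y.
rewrite !inE; case: (eqVneq x a) => [->|xa] /=; case: (eqVneq y a) => [->|ya] //=.
- move=> _ _ _ ray; apply: contra Hk => /eqP->.
  by apply: imset_f; rewrite inE.
- move=> _ _ _; rewrite rC => ray; apply: contra Hk => /eqP<-.
  by apply: imset_f; rewrite inE.
exact: IH.
Qed.

(** A good vertex of the whole set gets the top rank and the rest is ranked recursively: the
    vertices ranked at most as high as [v] are then exactly those still present when [v] is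
    removed. *)
Lemma elimination_order (T : finType) (good : {set T} -> T -> Prop) :
  (forall S : {set T}, S != set0 -> exists2 v, v \in S & good S v) ->
  exists2 rk : T -> nat, injective rk & forall v, good [set y | rk y <= rk v] v.
Proof.
move=> Hg.
suff H n (S : {set T}) : #|S| = n -> exists rk : T -> nat,
    [/\ {in S &, injective rk}, {in S, forall v, rk v < n}
      & {in S, forall v, good [set y in S | rk y <= rk v] v}].
  have [rk [h1 _ h3]] := H _ [set: T] erefl.
  exists rk => [x y|v]; first by apply: h1.
  by have := h3 v (in_setT v); congr good; apply/setP => y; rewrite !inE.
elim: n S => [|n IH] S HS.
  by exists (fun=> 0); move/eqP: HS; rewrite cards_eq0 => /eqP->; split=> x; rewrite inE.
have [|v vS gv] := Hg S; first by rewrite -cards_eq0 HS.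
have [|rk [h1 h2 h3]] := IH (S :\ v); first by move: HS; rewrite (cardsD1 v) vS => -[].
have lt x : x \in S -> x != v -> rk x < n by move=> xS xv; apply: h2; rewrite !inE xv.
exists (fun x => if x == v then n else rk x); split.
- move=> x y xS yS; case: (eqVneq x v) => [->|xv]; case: (eqVneq y v) => [->|yv] //.
  + by move=> E; have := lt _ yS yv; rewrite -E ltnn.
  + by move=> E; have := lt _ xS xv; rewrite E ltnn.
  by apply: h1; rewrite !inE ?xv ?yv.
- by move=> x xS; case: eqVneq => // xv; rewrite ltnS ltnW ?lt.
move=> x xS; case: eqVneq => [->|xv].
  move: gv; congr good; apply/setP => y; rewrite !inE; case: (boolP (y \in S)) => //= yS.
  by case: eqVneq => [|yv]; rewrite ?leqnn // ltnW ?lt.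
have := h3 x; rewrite !inE xv => /(_ xS); congr good; apply/setP => y; rewrite !inE.
case: (eqVneq y v) => [->|] //=; rewrite leqNgt lt ?andbF //.
Qed.

(** * Cycles in edge sets with more edges than vertices *)

Section DenseCycle.
Variables (V E : finType) (ends : E -> V * V).

Definition induced (A : {set E}) (U : {set V}) : {set E} :=
  [set e in A | ((ends e).1 \in U) && ((ends e).2 \in U)].

(** Take [U] smallest among the vertex sets spanning more edges of [A] than they have vertices.
    Deleting [v] destroys this excess, so at least two of the spanned edges meet [v], and a list of
    at most one edge misses one of them. *)
Lemma dense_core (A : {set E}) : #|V| < #|A| -> exists U : {set V}, U != set0 /\
  forall v (es : seq E), v \in U -> size es <= 1 -> exists e z,
    [/\ e \in A, e \notin es, z \in U & joins ends e z v].
Proof.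
move=> Hc; pose P (U : {set V}) := #|U| < #|induced A U|.
have PT : P setT.
  rewrite /P cardsT (_ : induced A setT = A) //.
  by apply/setP => e; rewrite !inE !andbT.
case: (arg_minnP (fun U : {set V} => #|U|) PT) => U PU Umin; exists U; split.
  apply: contraTneq PU => ->; rewrite /P -leqNgt cards0 leqn0 cards_eq0.
  by apply/eqP/setP => e; rewrite !inE !andbF.
move=> v es vU es1.
have lt1 : #|induced A (U :\ v)| <= #|U :\ v|.
  rewrite leqNgt; apply/negP => h; have := Umin _ h.
  by rewrite (cardsD1 v U) vU ltnn.
have sub : induced A (U :\ v) \subset induced A U.
  apply/subsetP => e; rewrite !inE => /and3P[-> /andP[_ ->] /andP[_ ->]] //.
have : 1 < #|induced A U :\: induced A (U :\ v)|.
  rewrite cardsD (setIidPr sub); move: PU lt1; rewrite /P (cardsD1 v U) vU; lia.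
move=> card2; have : 0 < #|(induced A U :\: induced A (U :\ v)) :\: [set e in es]|.
  have h : #|[set e in es]| <= 1.
    by rewrite cardsE (leq_trans (card_size _)).
  rewrite cardsD subn_gt0 (leq_ltn_trans _ card2) // (leq_trans _ h) //.
  exact: subset_leq_card (subsetIr _ _).
case/card_gt0P => e; rewrite !inE => /and3P[ne h1 /and3P[eA e1 e2]].
move: h1; rewrite eA e1 e2 !andbT /= negb_and !negbK => h1.
have := joins_ends ends e; case/orP: h1 => /eqP -> h.
  by exists e, (ends e).2; rewrite joinsC.
by exists e, (ends e).1.
Qed.

(** A longest path within the core cannot be prolonged at its start [x], so an edge of the core at
    [x] other than the first edge of the path leads back to the path and closes a cycle. *)
Lemma dense_has_cycle (A : {set E}) : loopless ends -> #|V| < #|A| ->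
  exists x s, closed_walk ends x s /\ {subset edg s <= A}.
Proof.
move=> ll /dense_core[U [U0 HU]].
pose Q x s := [/\ spath ends x s, {subset x :: vtx s <= U} & {subset edg s <= A}].
have exQ : exists n, pb (exists x s, Q x s /\ size s = n).
  case/set0Pn: U0 => x xU; exists 0; apply/pbP; exists x, [::]; split=> //.
  by split=> // y; rewrite inE => /eqP->.
have bdQ n : pb (exists x s, Q x s /\ size s = n) -> n <= #|V|.
  case/pbP => x [s [[/andP[_ us] _ _] <-]].
  have := card_uniqP us; rewrite /= size_map => h.
  by apply: ltnW; rewrite -h max_card.
case: (ex_maxnP exQ bdQ) => n /pbP[x [s [[sp sU sA] sn]]] nmax.
(* [take 1 s] holds the first edge of the path, or nothing when the path is a single vertex. *)
have [e [z [eA ne zU ez]]] : exists e z,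
    [/\ e \in A, e \notin edg (take 1 s), z \in U & joins ends e z x].
  have xU : x \in U by apply: sU; rewrite mem_head.
  by apply: HU => //; rewrite size_map size_take; case: ifP => //; rewrite ltnNge => /negbFE.
have [zs|zs] := boolP (z \in x :: vtx s); last first.
  suff /nmax : pb (exists x s, Q x s /\ size s = n.+1) by rewrite ltnn.
  apply/pbP; exists z, ((e, x) :: s); split; last by rewrite /= sn.
  split.
  - by move: sp; rewrite /spath => /andP[w u]; rewrite /= ez w zs.
  - by move=> w; rewrite /= inE => /orP[/eqP->|] //; apply: sU.
  - by move=> w; rewrite /= inE => /orP[/eqP->|] //; apply: sA.
have zx := joins_neq ll ez; move: zs; rewrite inE (negbTE zx) /= => zs.
have ns : e \notin edg s.
  move: ne sp; case: (s) => [|[e1 y] s'] //=; rewrite take0 !inE => ne.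
  case/andP=> /= /andP[h1 h2] /andP[nx _]; rewrite negb_or ne; apply: contra nx => h.
  by apply: (walk_mem h2 h); rewrite joinsC; exact: ez.
have [a [e' [b sE]]] := split_vertex zs.
move: sp ns sA; rewrite sE -cat_rcons => /spath_cat[sp _] ns sA.
exists z, ((e, x) :: rcons a (e', z)); split; last first.
  move=> w; rewrite /= inE => /orP[/eqP->|] // h; apply: sA.
  by rewrite map_cat mem_cat h.
have ue := spath_uniq_edges sp; case/andP: sp => w u.
have We : last x (vtx (rcons a (e', z))) = z by rewrite map_rcons last_rcons.
move: u => /= /andP[u1 u2]; rewrite /closed_walk /wend /= ez w We eqxx u1 u2 ue /=.
by move: ns; rewrite map_cat mem_cat negb_or => /andP[-> _]; rewrite size_rcons.
Qed.

End DenseCycle.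

(** * The density parameter *)

Section Density.
Variables (V E : finType) (ends : E -> V * V) (k : nat).

Lemma subdiv_in_card (VH EH : finType) (endsH : EH -> VH * VH) :
  subdiv_in ends endsH k -> #|VH| <= #|V| /\ #|EH| <= #|E|.
Proof.
case=> phi [pv [pe [phiI Hp Hd]]]; split; first exact: leq_card phiI.
have /fin_all_exists[g Hg] f : exists e, e \in pe f.
  have [[/andP[h _] h2 _ _] _] := Hp f; move: h; rewrite -h2.
  by case: (pe f) => // e es _; exists e; rewrite mem_head.
apply: (leq_card g) => f f' E'; apply: contraTeq isT => /Hd[/hasP H _].
by case: H; exists (g f) => //=; rewrite E'.
Qed.

(** Multiplied out, the bound also covers graphs without vertices. Otherwise, relabelling along
    [enum_rank] and [enum_val] turns [H] into one of the graphs on ordinals over which the maximum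
    runs. *)
Lemma le_nabla_m (VH EH : finType) (endsH : EH -> VH * VH) :
  loopless endsH -> subdiv_in ends endsH k ->
  (#|EH|%:R <= nabla_m ends k * #|VH|%:R :> rat)%R.
Proof.
move=> ll sub; have [cV cE] := subdiv_in_card sub.
have [/eqP V0|V0] := boolP (#|VH| == 0).
  suff -> : #|EH| = 0 by rewrite V0 mulr0.
  apply: eq_card0 => f; have := fintype0 (endsH f).1 V0; by [].
rewrite -ler_pdivrMr ?ltr0n ?lt0n //.
pose h := [ffun i : 'I_#|EH| =>
  (enum_rank (endsH (enum_val i)).1, enum_rank (endsH (enum_val i)).2)].
have lh : loopless h.
  by move=> i; rewrite ffunE /= (inj_eq enum_rank_inj).
have sh : subdiv_in ends h k.
  case: sub => phi [pv [pe [phiI Hp Hd]]].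
  exists (phi \o enum_val), (pv \o enum_val), (pe \o enum_val); split.
  - by move=> x y /= /phiI/enum_val_inj.
  - move=> i; rewrite ffunE /= !enum_rankK.
    have [h1 [h2 h3 h4]] := Hp (enum_val i); split=> //; split=> // v /h4.
    by apply: contra => /codomP[x ->]; rewrite /= codom_f.
  by move=> i j ij /=; apply: Hd; rewrite (inj_eq enum_val_inj).
rewrite /nabla_m.
apply: (@bigmax_sup _ _ _ 0%R (inord #|VH|)) => //.
rewrite inordK ?ltnS //.
apply: (@bigmax_sup _ _ _ 0%R (inord #|EH|)) => //.
rewrite inordK ?ltnS //.
apply: (@bigmax_sup _ _ _ 0%R h) => //.
exact/pbP.
Qed.

Lemma nabla_m_ge0 : (0 <= nabla_m ends k)%R.
Proof. exact: bigmax_ge_id. Qed.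

Lemma nabla_m_le (c : rat) : (0 <= c)%R ->
  (forall n m (h : 'I_m -> 'I_n * 'I_n), loopless h -> subdiv_in ends h k ->
    (m%:R <= c * n%:R)%R) ->
  (nabla_m ends k <= c)%R.
Proof.
move=> c0 H; apply: bigmax_le => // n _; apply: bigmax_le => // m _.
apply: bigmax_le => // h /pbP[h1 h2].
(* With denominator 0 the ratio is 0 by convention. *)
have [/eqP->|n0] := boolP (nat_of_ord n == 0); first by rewrite invr0 mulr0.
by rewrite ler_pdivrMr ?ltr0n ?lt0n // (H _ _ h).
Qed.

(** An integer stand-in for the density: its integer part plus one, which overshoots by at most
    1. *)
Lemma nabla_m_nat_bound : exists b : nat, (b%:R <= nabla_m ends k + 1)%R /\
  forall (VH EH : finType) (endsH : EH -> VH * VH),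
    loopless endsH -> subdiv_in ends endsH k -> #|EH| <= b * #|VH|.
Proof.
have /andP[h1 h2] := Num.Theory.truncn_itv nabla_m_ge0.
exists (Num.truncn (nabla_m ends k)).+1; split; first by rewrite -natr1 lerD2r.
move=> VH EH endsH ll /(le_nabla_m ll) h.
rewrite -(ler_nat rat) natrM; apply: le_trans h _.
by rewrite ler_wpM2r // ltW.
Qed.

End Density.

(** * The lower bound *)

Lemma uniq_flatten_map (I T : eqType) (F : I -> seq T) (s : seq I) : uniq s ->
  {in s, forall i, uniq (F i)} ->
  {in s &, forall i j, i != j -> ~~ has (mem (F j)) (F i)} ->
  uniq (flatten (map F s)).
Proof.
elim: s => //= i s IH /andP[ni us] h1 h2; rewrite cat_uniq IH // ?h1 ?mem_head //=.
- rewrite andbT; apply/hasPn => y /flatten_mapP[j js yj]; apply/negP => yi.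
  have ji : j != i by apply: contraNneq ni => <-.
  have := h2 j i; rewrite inE js orbT mem_head => /(_ isT isT ji)/hasPn/(_ y yj).
  by rewrite /= yi.
- by move=> j js; apply: h1; rewrite inE js orbT.
by move=> j l js ls; apply: h2; rewrite inE ?js ?ls orbT.
Qed.

Section LowerBound.
Variables (V E : finType) (ends : E -> V * V).
Variables (VH EH : finType) (endsH : EH -> VH * VH) (k : nat).
Variables (phi : VH -> V) (pv : EH -> seq V) (pe : EH -> seq E).
Hypothesis Hpath : forall f, let x := phi (endsH f).1 in
  [/\ 0 < size (pv f) <= k.+1, size (pe f) = size (pv f),
      uniq (x :: pv f) & uniq (pe f)] /\
  [/\ last x (pv f) = phi (endsH f).2,
      all (fun t => joins ends t.1 t.2.1 t.2.2) (zip (pe f) (zip (x :: pv f) (pv f)))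
    & forall v, v \in interior (pv f) -> v \notin codom phi].

(** The subdividing path is given in one orientation only; traversing [f] the other way takes its
    reverse, hence the lists are described up to permutation. *)
Lemma lift_edge f x y : joins endsH f x y -> exists t,
  [/\ walk ends (phi x) t, wend (phi x) t = phi y, perm_eq (edg t) (pe f)
    & perm_eq (vtx t) (phi y :: interior (pv f))].
Proof.
have /= [[h1 h2 _ _] [h3 h4 _]] := Hpath f; rewrite all_joinsE in h4.
have [w Ew] : exists w, pv f = rcons w (phi (endsH f).2).
  move: h1 h3; case/lastP: (pv f) => // w z _; rewrite last_rcons => ->.
  by exists w.
rewrite Ew interior_rcons => /orP[]/eqP Ef; move: h2 h3 h4; rewrite Ew Ef /= => h2 h3 h4.
  exists (zip (pe f) (rcons w (phi y))); split=> //.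
  - by rewrite /wend vtx_zip // last_rcons.
  - by rewrite edg_zip.
  by rewrite vtx_zip // perm_rcons.
have [t] := walk_rev h4; rewrite /wend edg_zip // vtx_zip // last_rcons.
rewrite rev_cons rev_rcons rcons_cons => -[w1 w2 w3 [w4]]; exists t; split=> //.
  by rewrite w3 perm_rev.
by rewrite w4 perm_rcons perm_cons perm_rev.
Qed.

Lemma lift_walk x s : walk endsH x s -> exists t,
  [/\ walk ends (phi x) t, wend (phi x) t = phi (wend x s),
      perm_eq (edg t) (flatten (map pe (edg s)))
    & perm_eq (vtx t) (map phi (vtx s) ++ flatten (map (fun f => interior (pv f)) (edg s)))].
Proof.
elim: s x => [|[f y] s IH] x; first by exists [::].
case/andP=> /lift_edge[t1 [a1 a2 a3 a4]] /IH[t2 [b1 b2 b3 b4]].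
exists (t1 ++ t2); rewrite walk_cat wend_cat a1 a2 b1 b2 !map_cat; split=> //.
  exact: perm_cat.
rewrite /= (perm_trans (perm_cat a4 b4)) //= perm_cons perm_catCA.
by rewrite perm_cat2l.
Qed.

Hypothesis phiI : injective phi.
Hypothesis Hdisj : forall f f', f != f' ->
  ~~ has (mem (pe f')) (pe f) /\ ~~ has (mem (interior (pv f'))) (interior (pv f)).

Lemma lift_cycle x s : closed_walk endsH x s ->
  exists C : {set E}, [/\ is_cycle ends C, C =i flatten (map pe (edg s))
    & #|C| = size (flatten (map pe (edg s)))].
Proof.
case/and5P=> /lift_walk[t [w1 w2 w3 w4]] /eqP We u1 u2 s2.
have ut : uniq (edg t).
  rewrite (perm_uniq w3); apply: uniq_flatten_map => // [f _|f f' _ _ /Hdisj[]//].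
  by have [[]] := Hpath f.
exists [set e in edg t]; split.
- apply/closed_walkP; exists (phi x), t; split=> //.
  rewrite /closed_walk w1 w2 We eqxx ut (perm_uniq w4) cat_uniq map_inj_uniq // u1 /=.
  rewrite -andbA; apply/and3P; split.
  + apply/hasPn => v /flatten_mapP[f _ /= vf].
    have [_ [_ _ /(_ v vf)]] := Hpath f; apply: contra => /mapP[z _ ->].
    exact: codom_f.
  + apply: uniq_flatten_map => // [f _|f f' _ _ /Hdisj[]//] /=.
    have [[_ _ /= /andP[_ u] _] _] := Hpath f.
    exact: take_uniq.
  rewrite -(size_map fst) (perm_size w3); move: s2 {w2 w3 w4 u1 u2 We}.
  case: s => [|[f1 y1] [|[f2 y2] s]] //= _; rewrite !size_cat.
  have [[/andP[h1 _] -> _ _] _] := Hpath f1.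
  have [[/andP[h2 _] -> _ _] _] := Hpath f2.
  by lia.
- by move=> e; rewrite inE (perm_mem w3).
by rewrite cardsE (card_uniqP ut) (perm_size w3).
Qed.

End LowerBound.

(* Edges of H whose subdividing paths carry the same (padded) colour word span a forest: a cycle
   among them would lift to a cycle of G that sees every colour at least twice. *)
Lemma subdiv_in_card_edges (V E : finType) (ends : E -> V * V) (p N : nat)
    (col : E -> 'I_N) (VH EH : finType) (endsH : EH -> VH * VH) :
  0 < p -> arb_colouring ends p col -> loopless endsH -> subdiv_in ends endsH p.-1 ->
  #|EH| <= N ^ p * #|VH|.
Proof.
move=> p0 Hcol ll [phi [pv [pe [phiI Hp Hd]]]].
have /fin_all_exists[g Hg] f : exists e, e \in pe f.
  have [[/andP[h _] h2 _ _] _] := Hp f; move: h; rewrite -h2.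
  by case: (pe f) => // e es _; exists e; rewrite mem_head.
(* A path with fewer than [p] edges is padded with the colour of one of its own edges, which leaves
   its set of colours unchanged. *)
pose word f := [ffun i : 'I_p => col (nth (g f) (pe f) i)].
rewrite leqNgt; apply/negP => big.
(* Pigeonhole over the [N ^ p] possible words. *)
have [c Hc] : exists c, #|VH| < #|[set f | word f == c]|.
  apply/existsP; apply: contraTT big; rewrite negb_exists -leqNgt => /forallP H.
  rewrite -sum1_card (partition_big word xpredT) //=.
  apply: (@leq_trans (\sum_(c : {ffun 'I_p -> 'I_N}) #|VH|)).
    apply: leq_sum => c _; have := H c; rewrite -leqNgt; apply: leq_trans.
    by rewrite -sum1_card; apply/eq_leq/eq_bigl => f; rewrite inE.
  by rewrite sum_nat_const card_ffun !card_ord.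
have [x [s [cw sA]]] := dense_has_cycle ll Hc.
have [C [Ccyc CE Cc]] := lift_cycle Hp phiI Hd cw.
pose S := c @: setT.
have colS f : f \in edg s -> col @: [set e in pe f] = S.
  move/sA; rewrite inE /S => /eqP <-; apply/setP => a; apply/imsetP/imsetP.
  - case=> e; rewrite inE => ef ->.
    have lt : index e (pe f) < p.
      have [[/andP[_ h1] h2 _ _] _] := Hp f; rewrite -[p]prednK // -h2 in h1 *.
      by apply: leq_trans h1; rewrite index_mem.
    by exists (Ordinal lt); rewrite // ffunE nth_index.
  case=> i _ ->; rewrite ffunE; exists (nth (g f) (pe f) i) => //; rewrite inE.
  by have [h|h] := ltnP i (size (pe f)); [rewrite mem_nth | rewrite nth_default].
have sizeS f : f \in edg s -> #|S| <= size (pe f).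
  move=> fs; rewrite -(colS f fs) (leq_trans (leq_imset_card _ _)) //.
  by rewrite cardsE card_size.
have S0 : 0 < #|S| by apply/card_gt0P; exists (c (Ordinal p0)); apply: imset_f.
have Sp : #|S| <= p by rewrite (leq_trans (leq_imset_card _ _)) // cardsT card_ord.
have colC : #|col @: C| <= #|S|.
  apply: subset_leq_card; apply/subsetP => a /imsetP[e]; rewrite CE => /flatten_mapP[f fs ef] ->.
  by rewrite -(colS f fs); apply: imset_f; rewrite inE.
(* The lifted cycle contains two paths of at least [#|S|] edges each, so it has more than [#|S|]
   edges; as also [#|S| <= p], it would need more than [#|S|] colours. *)
have := leq_trans (Hcol C Ccyc) colC; rewrite Cc.
have /and5P[_ _ _ _] := cw; move: sizeS; case: (s) => [|[f1 y1] [|[f2 y2] s']] //= H _.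
rewrite !size_cat; have := H f1; have := H f2; rewrite !inE !eqxx orbT /=.
move=> /(_ isT) h2 /(_ isT) h1; move: S0 Sp h1 h2; move: #|S| (size (flatten _)) => a b; lia.
Qed.

(** * Edges on short paths with both ends in a given set *)

Lemma card_bigcup_le (I T : finType) (P : pred I) (F : I -> {set T}) :
  #|\bigcup_(i | P i) F i| <= \sum_(i | P i) #|F i|.
Proof.
elim/big_ind2: _ => [|m A n B mA nB|//]; first by rewrite cards0.
by rewrite (leq_trans (leq_card_setU _ _)) // leq_add.
Qed.

Section ShortPaths.
Variables (V E : finType) (ends : E -> V * V).

Definition short_path_edges (q : nat) (S : {set V}) : {set E} :=
  [set e | pb (exists x s, [/\ spath ends x s, size s <= q, x \in S, wend x s \in S
                             & e \in edg s])].

(* An ear of [S]: a path of between 2 and [q] edges that meets [S] exactly in its ends. *)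
Definition ear (q : nat) (S : {set V}) (x : V) (s : seq (E * V)) : Prop :=
  [/\ spath ends x s, 1 < size s <= q, x \in S, wend x s \in S
    & forall v, v \in interior (vtx s) -> v \notin S].

Lemma ear_edge_interior q S x s e : ear q S x s -> e \in edg s ->
  exists z w, z \in interior (vtx s) /\ joins ends e z w.
Proof.
case=> /andP[w _] /andP[s2 _] _ _ _ /split_edge[a [v [b sE]]].
move: w s2; rewrite {}sE walk_cat => /and3P[_ he _].
case/lastP: b => [|b [e' w]].
  rewrite cats1 size_rcons map_rcons interior_rcons ltnS.
  case/lastP: a he => // a [e' z]; rewrite /wend map_rcons last_rcons => he _.
  by exists z, v; rewrite mem_rcons mem_head.
move=> _; exists v, (wend x a); rewrite -rcons_cons -rcons_cat map_rcons interior_rcons.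
by rewrite map_cat mem_cat mem_head orbT joinsC.
Qed.

(** An ear has at least two edges, so each of its edges has an end in its interior. For a shared
    edge this end lies on the other ear too and, being outside [S], in the interior there. *)
Lemma ear_disjoint_edges q S x s y t : ear q S x s -> ear q S y t ->
  ~~ has (mem (interior (vtx t))) (interior (vtx s)) -> ~~ has (mem (edg t)) (edg s).
Proof.
move=> hs ht /hasPn hd; apply/hasPn => e es; apply/negP => /= et.
have [z [w [zs hj]]] := ear_edge_interior hs es.
have [_ _ _ _ /(_ z zs) zS] := hs; move/negP: (hd z zs); apply => /=.
have [/andP[wt _] _ yS eS _] := ht.
have := walk_mem wt et hj; move: eS; rewrite /wend; case/lastP: (t) => [|t' [e0 y0]] /=.
  by move=> _; rewrite inE => /eqP E'; rewrite E' yS in zS.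
rewrite map_rcons last_rcons interior_rcons inE mem_rcons inE => y0S.
by case/or3P=> // /eqP E'; rewrite E' ?yS ?y0S in zS.
Qed.

Variables (p b : nat).
Hypothesis p_gt0 : 0 < p.
Hypothesis Hll : loopless ends.
Hypothesis Hb : forall (VH EH : finType) (endsH : EH -> VH * VH),
  loopless endsH -> subdiv_in ends endsH p.-1 -> #|EH| <= b * #|VH|.

(** The paths realise a subdivision of the multigraph on [S] with one edge per path, to which the
    density bound applies. It is loopless because the paths are nonempty and never revisit their
    start. *)
Lemma path_family_card (S : {set V}) (I : finType) (src : I -> V) (pth : I -> seq (E * V)) :
  (forall i, [/\ spath ends (src i) (pth i), 0 < size (pth i) <= p, src i \in S,
     wend (src i) (pth i) \in S & forall v, v \in interior (vtx (pth i)) -> v \notin S]) ->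
  (forall i j, i != j -> ~~ has (mem (edg (pth j))) (edg (pth i)) /\
     ~~ has (mem (interior (vtx (pth j)))) (interior (vtx (pth i)))) ->
  #|I| <= b * #|S|.
Proof.
move=> H Hd; have h1 i : src i \in S by have [] := H i.
have h2 i : wend (src i) (pth i) \in S by have [] := H i.
pose endsH i := (exist (fun x => x \in S) _ (h1 i), exist (fun x => x \in S) _ (h2 i)).
have <- : #|{: {x : V | x \in S}}| = #|S| by rewrite card_sig.
apply: (@Hb _ _ endsH) => [i|].
  rewrite -val_eqE /=; have [/andP[_ /= /andP[ni _]] /andP[s0 _] _ _ _] := H i.
  apply: contra ni => /eqP E'; rewrite {1}E'; move: s0; rewrite /wend.
  by case: (pth i) => //= -[e y] s _ /=; rewrite mem_last.
exists val, (fun i => vtx (pth i)), (fun i => edg (pth i)); split; last exact: Hd.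
  exact: val_inj.
move=> i /=; have [sp hs _ _ hi] := H i; have ue := spath_uniq_edges sp.
case/andP: sp => w u; rewrite !size_map prednK // hs all_joinsE zip_edg_vtx w.
split; split=> // v /hi; apply: contra => /codomP[x ->]; exact: valP.
Qed.

Lemma short_path_edges1 (S : {set V}) : #|short_path_edges 1 S| <= b * #|S|.
Proof.
have -> : #|short_path_edges 1 S| = #|{: {e : E | e \in short_path_edges 1 S}}|.
  by rewrite card_sig.
pose src (i : {e : E | e \in short_path_edges 1 S}) := (ends (val i)).1.
pose pth (i : {e : E | e \in short_path_edges 1 S}) := [:: (val i, (ends (val i)).2)].
apply: (@path_family_card S _ src pth) => [i|i j ij]; last first.
  by split=> //=; rewrite orbF inE val_eqE.
have := valP i; rewrite inE => /pbP[x [s [/andP[w _] s1 xS yS es]]].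
case: s s1 es w yS => [|[e y] [|//]] //= _; rewrite inE => /eqP Ei /andP[hj _] yS.
rewrite /spath /= joins_ends inE Hll /src /pth /wend /= -/(val i) Ei.
by move: hj; rewrite /joins => /orP[]/eqP ->; split.
Qed.

Definition ear_family (q : nat) (S : {set V}) (n : nat) : Prop :=
  exists (I : finType) (src : I -> V) (pth : I -> seq (E * V)),
  [/\ #|I| = n, forall i, ear q S (src i) (pth i)
    & forall i j, i != j -> ~~ has (mem (interior (vtx (pth j)))) (interior (vtx (pth i)))].

Lemma ear_family_card q S n : q <= p -> ear_family q S n -> n <= b * #|S|.
Proof.
move=> qp [I [src [pth [<- h1 h2]]]]; apply: (path_family_card (src := src) (pth := pth)).
  move=> i; have [a1 /andP[a2 a3] a4 a5 a6] := h1 i; split=> //.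
  by rewrite (ltnW a2) (leq_trans a3).
move=> i j ij; have hd := h2 i j ij; split=> //.
exact: ear_disjoint_edges (h1 i) (h1 j) hd.
Qed.

(* Adding to [S] the interiors of a maximal family of disjoint ears hits every longer path. *)
Lemma short_path_edgesS q (S : {set V}) : q.+2 <= p -> exists S' : {set V},
  #|S'| <= (1 + p * b) * #|S| /\ short_path_edges q.+2 S \subset short_path_edges q.+1 S'.
Proof.
move=> qp.
have ex0 : exists n, pb (ear_family q.+2 S n).
  exists 0; apply/pbP; exists void, (fun v : void => match v with end),
    (fun v : void => match v with end).
  by split=> [|[]|[]]; rewrite card_void.
have bd n : pb (ear_family q.+2 S n) -> n <= b * #|S|.
  by move/pbP; apply: ear_family_card.
case: (ex_maxnP ex0 bd) => n /pbP Hn nmax.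
have nb := ear_family_card qp Hn; case: Hn => I [src [pth [cI h1 h2]]].
pose M := \bigcup_i [set v in interior (vtx (pth i))].
exists (S :|: M); split.
  have cM : #|M| <= n * p.
    apply: (leq_trans (card_bigcup_le _ _)).
    rewrite -cI -sum_nat_const; apply: leq_sum => i _.
    rewrite cardsE (leq_trans (card_size _)) // /interior size_take_min geq_min.
    have [_ /andP[_ hs] _ _ _] := h1 i; rewrite size_map.
    by rewrite (leq_trans (leq_pred _)) // (leq_trans hs).
  rewrite (leq_trans (leq_card_setU _ _)) // mulnDl mul1n leq_add2l (leq_trans cM) //.
  by rewrite mulnC -mulnA leq_mul2l nb orbT.
apply/subsetP => e; rewrite !inE => /pbP[x [s [sp ss xS eS es]]]; apply/pbP.
have [s1|s2] := leqP (size s) 1.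
  by exists x, s; rewrite !inE xS eS; split=> //; rewrite (leq_trans s1).
(* An interior vertex [v] in the enlarged set cuts the path into two strictly shorter ones with ends
   in that set, and [e] lies on one of them. *)
have [/hasP[v vs vSM]|none] := boolP (has (mem (S :|: M)) (interior (vtx s))).
  move: sp ss eS es vs; case/lastP: s s2 => [//|s [e0 y0]] _ sp ss eS es.
  rewrite map_rcons interior_rcons => /split_vertex[a [e1 [d sE]]].
  move: sp ss eS es; rewrite {}sE rcons_cat rcons_cons -cat_rcons wend_cat.
  move=> /spath_cat[sp1 sp2]; rewrite size_cat !size_rcons => ss.
  rewrite map_cat mem_cat => eS es; have Ev : wend x (rcons a (e1, v)) = v.
    by rewrite /wend map_rcons last_rcons.
  rewrite Ev in sp2 eS; case/orP: es => es.
    exists x, (rcons a (e1, v)); rewrite Ev inE xS size_rcons; split=> //; lia.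
  exists v, (rcons d (e0, y0)); rewrite size_rcons; split=> //; last by rewrite inE eS.
  by lia.
(* Otherwise the path is itself an ear disjoint from the whole family, against maximality. *)
have {}none v : v \in interior (vtx s) -> v \notin S :|: M by move/(hasPn none).
suff /nmax : pb (ear_family q.+2 S n.+1) by rewrite ltnn.
apply/pbP; exists (option I), (fun o => if o is Some i then src i else x),
  (fun o => if o is Some i then pth i else s).
have nM i v : v \in interior (vtx s) -> v \notin interior (vtx (pth i)).
  move/none; rewrite !inE negb_or => /andP[_]; apply: contra => vi.
  by apply/bigcupP; exists i => //; rewrite inE.
split; first by rewrite card_option cI.
  case=> [i|]; first exact: h1.
  by split=> //; [rewrite s2 | move=> v /none; rewrite inE negb_or => /andP[]].
case=> [i|] [j|] //.
- by move=> ij; apply: h2; apply: contra ij => /eqP->.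
- by move=> _; apply/hasPn => v vi; apply/negP => /= vs; move: (nM i v vs); rewrite vi.
by move=> _; apply/hasPn => v vs; exact: nM.
Qed.

Lemma card_short_path_edges q (S : {set V}) : q < p ->
  #|short_path_edges q.+1 S| <= (1 + p * b) ^ q.+1 * #|S|.
Proof.
elim: q S => [|q IH] S qp.
  rewrite (leq_trans (short_path_edges1 S)) // leq_mul2r expn1; apply/orP; right.
  by rewrite (leq_trans (leq_pmull b p_gt0)) // leq_addl.
have [S' [cS' sub]] := short_path_edgesS S qp.
rewrite (leq_trans (subset_leq_card sub)) // (leq_trans (IH _ (ltnW qp))) //.
by rewrite [_ ^ q.+2]expnSr -mulnA leq_mul2l cS' orbT.
Qed.

Definition out_edges (S : {set V}) (v : V) : {set E} :=
  [set e in short_path_edges p S | ((ends e).1 == v) || ((ends e).2 == v)].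

(** Averaging over [S]: each edge on a short path is counted at no more than its two ends. *)
Lemma exists_low_degree (S : {set V}) : S != set0 ->
  exists2 v, v \in S & #|out_edges S v| <= 2 * (1 + p * b) ^ p.
Proof.
move=> S0; set c := (1 + p * b) ^ p.
have cF : #|short_path_edges p S| <= c * #|S|.
  by have := @card_short_path_edges p.-1 S; rewrite prednK //; apply.
apply/exists_inP; apply: contraTT isT; rewrite negb_exists_in => /forall_inP H.
have low : (2 * c).+1 * #|S| <= \sum_(v in S) #|out_edges S v|.
  by rewrite mulnC -sum_nat_const; apply: leq_sum => v vS; rewrite ltnNge H.
have up : \sum_(v in S) #|out_edges S v| <= 2 * #|short_path_edges p S|.
  under eq_bigr do rewrite -sum1_card.
  rewrite (exchange_big_dep (mem (short_path_edges p S))) /=; last first.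
    by move=> v e _; rewrite inE => /andP[].
  rewrite mulnC -sum_nat_const; apply: leq_sum => e _.
  rewrite sum1_card; apply: (@leq_trans #|[set (ends e).1; (ends e).2]|).
    apply: subset_leq_card; apply/subsetP => v; rewrite unfold_in /= => /andP[_].
    rewrite !inE => /andP[_].
    by case/orP=> /eqP->; rewrite eqxx ?orbT.
  by rewrite cards2; case: eqP.
have S1 : 0 < #|S| by rewrite card_gt0.
have := leq_trans low (leq_trans up (leq_mul (leqnn 2) cF)).
by rewrite mulSn mulnA; lia.
Qed.

End ShortPaths.

(** * The upper bound *)

Lemma closed_walk_rot (V E : finType) (ends : E -> V * V) x s u :
  closed_walk ends x s -> u \in vtx s -> exists t,
  [/\ closed_walk ends u t, perm_eq (edg t) (edg s) & perm_eq (vtx t) (vtx s)].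
Proof.
move=> cw /split_vertex[a [e [b sE]]]; exists (b ++ rcons a (e, u)).
have ps : perm_eq (b ++ rcons a (e, u)) s by rewrite sE -cat_rcons perm_catC.
have pe := perm_map fst ps; have pv := perm_map snd ps; split=> //.
case/and5P: cw => w /eqP we u1 u2 s2.
rewrite /closed_walk (perm_uniq pe) (perm_uniq pv) (perm_size ps) u1 u2 s2.
move: w we; rewrite sE -!cat_rcons !walk_cat !wend_cat => /andP[w1 w2] we.
have Eu y : wend y (rcons a (e, u)) = u by rewrite /wend map_rcons last_rcons.
by rewrite Eu in w2 we; rewrite w2 we w1 Eu eqxx.
Qed.

Section UpperBound.
Variables (V E : finType) (ends : E -> V * V) (p k : nat) (rk : V -> nat).
Hypothesis p_gt0 : 0 < p.

Definition down_edges (v : V) : {set E} := out_edges ends p [set y | rk y <= rk v] v.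

Hypothesis Hk : forall v, #|down_edges v| <= k.

(** A down edge of one end need not be a down edge of the other; asking for both makes the relation
    symmetric. *)
Definition near (x : V) : {set V} :=
  [set y | (y == x) || [exists e, [&& e \in down_edges x, e \in down_edges y
                                    & joins ends e x y]]].

Lemma near_sym x y : (y \in near x) = (x \in near y).
Proof.
rewrite !inE eq_sym; congr (_ || _); apply: eq_existsb => e.
by rewrite andbCA joinsC.
Qed.

Lemma card_near x : #|near x| <= k.+1.
Proof.
pose other e := if (ends e).1 == x then (ends e).2 else (ends e).1.
apply: (@leq_trans #|x |: other @: down_edges x|).
  apply: subset_leq_card; apply/subsetP => y; rewrite !inE => /orP[->//|].
  case/existsP=> e /and3P[ex _ hj]; apply/orP; right; apply/imsetP; exists e => //.
  by case/orP: hj => /eqP h; rewrite /other h /= ?eqxx //; case: eqP.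
rewrite cardsU1 -addn1 addnC leq_add ?leq_b1 //.
exact: leq_trans (leq_imset_card _ _) (Hk x).
Qed.

Fixpoint ball (n : nat) (x : V) : {set V} :=
  if n is n'.+1 then \bigcup_(y in ball n' x) near y else [set x].

Lemma card_ball n x : #|ball n x| <= k.+1 ^ n.
Proof.
elim: n => [|n IH] /=; first by rewrite cards1.
apply: leq_trans (card_bigcup_le _ _) _.
apply: (@leq_trans (\sum_(y in ball n x) k.+1)).
  by apply: leq_sum => y _; exact: card_near.
by rewrite sum_nat_const expnSr leq_mul2r IH orbT.
Qed.

Lemma ball_step n x y z : y \in ball n x -> z \in near y -> z \in ball n.+1 x.
Proof. by move=> yb zy; apply/bigcupP; exists y. Qed.

Lemma ball_cat m n x y z : y \in ball m x -> z \in ball n y -> z \in ball (m + n) x.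
Proof.
move=> yb; elim: n z => [|n IH] z /=; first by rewrite inE addn0 => /eqP->.
by case/bigcupP=> w /IH wb zw; rewrite addnS; apply: ball_step wb zw.
Qed.

Lemma ball_sym n x y : y \in ball n x -> x \in ball n y.
Proof.
elim: n y => [|n IH] y /=; first by rewrite !inE eq_sym.
case/bigcupP=> w /IH xw yw; suff: x \in ball (1 + n) y by []; apply: ball_cat xw.
by apply: (@ball_step 0 y y); [rewrite inE | rewrite near_sym].
Qed.

Lemma ball_mono m n x y : m <= n -> y \in ball m x -> y \in ball n x.
Proof.
move=> mn; rewrite -(subnKC mn) => yb; elim: (n - m) => [|d IH]; first by rewrite addn0.
by rewrite addnS; apply: ball_step IH _; rewrite inE eqxx.
Qed.

(** The radius is [p + p] because the edges to be separated are down edges of vertices within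
    distance [p] of a common vertex. *)
Definition conflict (e e' : E) : bool :=
  [exists x, exists y, [&& e \in down_edges x, e' \in down_edges y & y \in ball (p + p) x]].

Lemma conflict_sym : symmetric conflict.
Proof.
suff H e e' : conflict e e' -> conflict e' e by move=> e e'; apply/idP/idP; apply: H.
case/existsP=> x /existsP[y /and3P[h1 h2 /ball_sym h3]].
by apply/existsP; exists y; apply/existsP; exists x; rewrite h1 h2.
Qed.

Lemma card_conflict e : #|[set e' | conflict e e']| <= 2 * (k.+1 ^ (p + p) * k).
Proof.
apply: (@leq_trans #|\bigcup_(x in [set (ends e).1; (ends e).2])
  \bigcup_(y in ball (p + p) x) down_edges y|).
  apply: subset_leq_card; apply/subsetP => e'; rewrite inE.
  case/existsP=> x /existsP[y /and3P[h1 h2 h3]]; apply/bigcupP; exists x.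
    by move: h1; rewrite !inE => /andP[_] /orP[]/eqP->; rewrite eqxx ?orbT.
  by apply/bigcupP; exists y.
apply: leq_trans (card_bigcup_le _ _) _.
apply: (@leq_trans (\sum_(x in [set (ends e).1; (ends e).2]) k.+1 ^ (p + p) * k)).
  apply: leq_sum => x _; apply: leq_trans (card_bigcup_le _ _) _.
  apply: (@leq_trans (\sum_(y in ball (p + p) x) k)).
    by apply: leq_sum => y _; exact: Hk.
  by rewrite sum_nat_const leq_mul2r card_ball orbT.
by rewrite sum_nat_const leq_mul2r cards2; case: (_ != _); rewrite orbT.
Qed.

(** A vertex [u] of the path before its end ranks no lower than [v], so both ends of the path rank
    at most [rk u], and the path itself shows its edges at [u] to be down edges of [u]. The witness
    is the tail of [e], reached along such edges. *)
Lemma edges_near v s e : spath ends v s -> size s <= p -> rk (wend v s) <= rk v ->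
  (forall w, w \in interior (vtx s) -> rk v <= rk w) -> e \in edg s ->
  exists2 z, e \in down_edges z & z \in ball p v.
Proof.
move=> sp sz rend hi es.
have inD e' u w : e' \in edg s -> joins ends e' u w -> rk v <= rk u -> e' \in down_edges u.
  move=> e's hj vu; rewrite !inE; apply/andP; split; last first.
    by case/orP: hj => /eqP->; rewrite eqxx ?orbT.
  by apply/pbP; exists v, s; rewrite !inE vu (leq_trans rend vu).
have [a [w [d sE]]] := split_edge es.
have hia u : u \in v :: vtx a -> rk v <= rk u.
  rewrite inE => /orP[/eqP->//|ua]; apply: hi.
  rewrite sE (lastI _ d) -rcons_cat map_rcons interior_rcons map_cat mem_cat ua //.
have /andP[ws _] := sp; move: ws; rewrite sE walk_cat => /and3P[wa hj _].
exists (wend v a); first by apply: inD es hj _; apply: hia; rewrite mem_last.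
apply: (@ball_mono (size a)).
  by rewrite (leq_trans _ sz) // sE size_cat leq_addr.
have sub : {subset edg a <= edg s} by move=> e' h; rewrite sE map_cat mem_cat h.
elim/last_ind: a wa hia sub {sE hj} => [|a [e1 u] IH]; first by rewrite inE.
rewrite -cats1 walk_cat /= andbT => /andP[wa hj] hia sub.
have {}IH : wend v a \in ball (size a) v.
  apply: IH wa _ _ => y h; first by apply: hia; rewrite map_cat -cat_cons mem_cat h.
  by apply: sub; rewrite map_cat mem_cat h.
have e1s : e1 \in edg s by apply: sub; rewrite map_cat mem_cat mem_head orbT.
rewrite wend_cat size_cat addn1 /=; apply: ball_step IH _; rewrite inE; apply/orP; right.
apply/existsP; exists e1; rewrite hj andbT; apply/andP; split.
  by apply: inD e1s hj _; apply: hia; rewrite map_cat -cat_cons mem_cat mem_last.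
apply: (inD _ _ (wend v a)) => //; first by rewrite joinsC.
by apply: hia; rewrite map_cat -cat_cons mem_cat mem_head orbT.
Qed.

Hypothesis rkI : injective rk.

(** The two ends may coincide, so that a cycle cut open at its least vertex is included. Splitting
    at the least interior vertex keeps the interior of each half above its ends, which makes
    induction on the length possible. *)
Lemma rainbow_arc (N : nat) (col : E -> 'I_N) :
  (forall e e', e != e' -> conflict e e' -> col e != col e') ->
  forall n x s, size s <= n -> walk ends x s -> uniq (vtx s) -> uniq (edg s) ->
  1 < size s ->
  (forall w, w \in interior (vtx s) -> rk x < rk w /\ rk (wend x s) < rk w) ->
  exists A : {set E}, [/\ {subset A <= edg s}, {in A &, injective col}
                        & minn (size s) p.+1 <= #|A|].
Proof.
move=> Hcol; elim=> [|n IH] x s sn ws uv ue s2 hi; first by lia.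
case/lastP: s s2 sn ws uv ue hi => [//|s [e0 y0]].
have -> : wend x (rcons s (e0, y0)) = y0 by rewrite /wend map_rcons last_rcons.
rewrite size_rcons ltnS map_rcons interior_rcons => s0 sn ws uv ue hi.
have [v0 v0s] : exists v0, v0 \in vtx s.
  by case: (s) s0 => // -[e v] s' _; exists v; rewrite mem_head.
case: (arg_minnP rk v0s) => v vs vmin.
have [a [e1 [b sE]]] := split_vertex vs.
set s1 := rcons a (e1, v); set t := rcons b (e0, y0).
have E' : rcons s (e0, y0) = s1 ++ t by rewrite sE rcons_cat rcons_cons -cat_rcons.
have Ev : wend x s1 = v by rewrite /wend map_rcons last_rcons.
have Ey : wend v t = y0 by rewrite /wend map_rcons last_rcons.
have szE : (size s).+1 = size s1 + size t by rewrite -size_cat -E' size_rcons.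
have t0 : 0 < size t by rewrite size_rcons.
have s10 : 0 < size s1 by rewrite size_rcons.
move: ws uv ue; rewrite -map_rcons E' walk_cat Ev !map_cat !cat_uniq.
move=> /andP[w1 w2] /and3P[u1 u12 u2] /and3P[q1 q12 q2].
have i1 w : w \in interior (vtx s1) -> rk x < rk w /\ rk v < rk w.
  rewrite map_rcons interior_rcons => wa.
  have ws : w \in vtx s by rewrite sE map_cat mem_cat wa.
  split; first by have [] := hi w ws.
  rewrite ltn_neqAle vmin // andbT (inj_eq rkI) eq_sym.
  by apply: contraTneq wa => ->; move: u1; rewrite map_rcons rcons_uniq => /andP[].
have vt : v \notin vtx t.
  apply: contra u12 => vt; apply/hasP; exists v => //=.
  by rewrite map_rcons mem_rcons mem_head.
have i2 w : w \in interior (vtx t) -> rk v < rk w /\ rk y0 < rk w.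
  rewrite map_rcons interior_rcons => wb.
  have ws : w \in vtx s by rewrite sE map_cat mem_cat inE wb !orbT.
  split; last by have [] := hi w ws.
  rewrite ltn_neqAle vmin // andbT (inj_eq rkI).
  by apply: contraNneq vt => ->; rewrite map_rcons mem_rcons inE wb orbT.
(* A half with more than [p] edges already supplies [p.+1] edges of distinct colours by
   induction. *)
have [big1|small1] := ltnP p (size s1).
  have [|||A [A1 A2 A3]] := IH x s1 _ w1 u1 q1 _ _; rewrite ?Ev //; try lia.
  exists A; split=> //; first by move=> e /A1 h; rewrite mem_cat h.
  by move: A3; rewrite (minn_idPr big1); apply: leq_trans (geq_minr _ _).
have [big2|small2] := ltnP p (size t).
  have [|||A [A1 A2 A3]] := IH v t _ w2 u2 q2 _ _; rewrite ?Ey //; try lia.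
  exists A; split=> //; first by move=> e /A1 h; rewrite mem_cat h orbT.
  by move: A3; rewrite (minn_idPr big2); apply: leq_trans (geq_minr _ _).
(* Both halves are short. Seen from [v], each is a path whose interior ranks above [v] and whose far
   end ranks below; the first half is reversed for this. *)
have [xv yv] : rk x < rk v /\ rk y0 < rk v by apply: hi.
have near1 e : e \in edg s1 -> exists2 z, e \in down_edges z & z \in ball p v.
  have sp : spath ends x s1.
    rewrite /spath w1 /= u1 andbT; apply/negP; rewrite map_rcons mem_rcons inE.
    case/orP=> [/eqP xv'|xa]; first by rewrite xv' ltnn in xv.
    by have [] := i1 x; rewrite ?map_rcons ?interior_rcons // ltnn.
  have [r [r1 r2 r3 r4]] := spath_rev sp; rewrite Ev in r1 r2 r4.
  move=> es; apply: (edges_near r1).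
  - by rewrite -(size_map fst) r3 size_rev size_map.
  - by rewrite r2 ltnW.
  - move=> w; move: r4; rewrite map_rcons rev_cons rev_rcons rcons_cons => -[->].
    rewrite interior_rcons mem_rev => wa; rewrite ltnW //.
    by have [] := i1 w; rewrite ?map_rcons ?interior_rcons.
  by rewrite r3 mem_rev.
have near2 e : e \in edg t -> exists2 z, e \in down_edges z & z \in ball p v.
  apply: edges_near => //; first by rewrite /spath w2 /= vt.
    by rewrite Ey ltnW.
  by move=> w /i2[/ltnW].
have near12 e : e \in edg s1 ++ edg t -> exists2 z, e \in down_edges z & z \in ball p v.
  by rewrite mem_cat => /orP[/near1|/near2].
have uq : uniq (edg s1 ++ edg t) by rewrite cat_uniq q1 q12.
exists [set e in edg s1 ++ edg t]; split; first by move=> e; rewrite inE.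
  move=> e e'; rewrite !inE => /near12[z ez zb] /near12[z' ez' zb'] /eqP.
  apply: contraTeq => ee'; apply: Hcol ee' _.
  apply/existsP; exists z; apply/existsP; exists z'; rewrite ez ez' /=.
  exact: ball_cat (ball_sym zb) zb'.
by rewrite cardsE (card_uniqP uq) size_cat !size_map -szE geq_minl.
Qed.

Lemma Arb_le : Arb ends p <= (2 * (k.+1 ^ (p + p) * k)).+1.
Proof.
have [col Hcol] := greedy_colouring conflict_sym card_conflict.
rewrite /Arb; case: ex_minnP => m _; apply; apply/pbP; exists col => C.
case/closed_walkP => x [s [cw ->]].
have [v0 v0s] : exists v0, v0 \in vtx s.
  case/and5P: cw => _ _ _ _; case: (s) => // -[e v] s' _; exists v.
  by rewrite mem_head.
case: (arg_minnP rk v0s) => u us umin.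
have [t [ct pe pv]] := closed_walk_rot cw us.
case/and5P: ct => wt /eqP et ut1 ut2 t2.
(* Both ends of the rotated walk are the least vertex [u], so every interior vertex ranks above
   them. *)
have [|A [A1 A2 A3]] := rainbow_arc Hcol (leqnn _) wt ut1 ut2 t2.
  move=> w; rewrite et; suff H : w \in interior (vtx t) -> rk u < rk w by move/H.
  move: ut1 et (perm_mem pv) t2; rewrite /wend; case/lastP: (t) => // t' [e y].
  rewrite map_rcons last_rcons interior_rcons rcons_uniq => /andP[nu _] Ey pm _ wt'.
  rewrite Ey in nu pm; rewrite ltn_neqAle (inj_eq rkI) umin; last first.
    by rewrite -[_ w]pm mem_rcons inE wt' orbT.
  by rewrite andbT eq_sym; apply: contraTneq wt' => ->.
have cC : #|[set e in edg s]| = size t.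
  have us' : uniq (edg s) by rewrite -(perm_uniq pe).
  by rewrite cardsE (card_uniqP us') -(perm_size pe) size_map.
rewrite cC (leq_trans A3) // -(card_in_imset A2); apply: subset_leq_card.
by apply: imsetS; apply/subsetP => e /A1; rewrite inE (perm_mem pe).
Qed.

End UpperBound.

Local Open Scope ring_scope.

(* nabla^{1/p} <= Arb_p is stated equivalently as nabla <= Arb_p ^ p
   (both sides nonnegative); r = (p-1)/2, i.e. 2r = p-1. *)
Theorem mainTheorem15 (R : realFieldType) (p : nat) (hp : (0 < p)%N) :
  exists P : {poly R},
    forall (V E : finType) (ends : E -> V * V), loopless ends ->
      (ratr (nabla_m ends p.-1) : R) <= (Arb ends p)%:R ^+ p /\
      ((Arb ends p)%:R : R) <= P.[ratr (nabla_m ends p.-1)].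
Proof.
(* [K] is the degree bound [2 * (1 + p * b) ^ p] with ['X + 1] for [b], as [b] exceeds the density
   by at most 1. The polynomial chosen next is the number of colours in [Arb_le] with [K] for
   [k]. *)
pose K : {poly R} := 2%:R *: (1 + p%:R *: ('X + 1)) ^+ p.
exists (2%:R *: ((K + 1) ^+ (p + p) * K) + 1) => V E ends ll; split.
  rewrite -natrX -ratr_nat ler_rat; apply: nabla_m_le; first exact: ler0n.
  move=> n m h lh sh; rewrite -natrM ler_nat.
  rewrite /Arb; case: ex_minnP => N /pbP[col Hcol] _.
  by have := subdiv_in_card_edges hp Hcol lh sh; rewrite !card_ord.
have [b [bn Hb]] := nabla_m_nat_bound ends p.-1.
(* The degree bound for [v] within its lower set is by definition the bound on [down_edges v]. *)
have [rk rkI Hk] := elimination_order (exists_low_degree hp ll Hb).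
have := Arb_le hp Hk rkI; set c := (2 * (1 + p * b) ^ p)%N => HA.
apply: (@le_trans _ _ ((2 * (c.+1 ^ (p + p) * c)).+1%:R)); first by rewrite ler_nat.
set x := ratr _; have bx : b%:R <= x + 1.
  by move: bn; rewrite -(ler_rat R) rmorphD rmorph1 ratr_nat.
have cK : c%:R <= K.[x].
  rewrite /K !hornerE natrM natrX natrD natrM ler_wpM2l // lerXn2r ?nnegrE //.
  - by rewrite addr_ge0 // mulr_ge0.
  - by rewrite addr_ge0 // mulr_ge0 // (le_trans _ bx).
  by rewrite lerD2l ler_wpM2l.
rewrite -[(_ * _).+1%:R]natr1 natrM [(_ * c)%:R]natrM natrX -[c.+1%:R]natr1.
rewrite hornerD hornerZ hornerM horner_exp hornerD hornerC.
rewrite lerD2r ler_wpM2l //.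
have K0 : 0 <= K.[x] by rewrite (le_trans _ cK).
rewrite ler_pM ?exprn_ge0 ?addr_ge0 // lerXn2r ?nnegrE ?addr_ge0 // lerD2r //.
Qed.
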